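(* Let $\mathbb W$, $C$ and $G$ be as in the context, and suppose there exists a prime $p\equiv 3\pmod 4$ dividing $m_i$ for some $1\le i\le l$. Then there is a subgroup $D\le C$ with $D\cap\langle\widehat{w_1}\rangle=1$ and $C=D\langle\widehat{w_1}\rangle$; for any such $D$ the short exact sequence $1\to\operatorname{Inn}(\mathbb W)\to\operatorname{Inn}(\mathbb W)C\to\operatorname{Inn}(\mathbb W)C/\operatorname{Inn}(\mathbb W)\to 1$ splits with $\operatorname{Inn}(\mathbb W)C=\operatorname{Inn}(\mathbb W)\rtimes D$, and $$\operatorname{Aut}(\mathbb W)=\big(\operatorname{Inn}(\mathbb W)\rtimes D\big)\rtimes G.$$
   Context: Fix an integer $n\ge 3$, pairwise distinct odd integers $m_1,\dots,m_l\ge 3$ and positive integers $k_1,\dots,k_l$ with $k_1+\cdots+k_l=n-1$. Partition $\{2,\dots,n\}$ into consecutive blocks $A_1=\{2,\dots,k_1+1\}$, $A_2=\{k_1+2,\dots,k_1+k_2+1\}$, …, $A_l$ (of sizes $k_1,\dots,k_l$), and put $t_i=m_j$ for $i\in A_j$. The star group is $\mathbb W=\langle w_1,\dots,w_n\mid w_j^2=1\ (1\le j\le n),\ (w_1w_i)^{t_i}=1\ (2\le i\le n)\rangle$. For $2\le i\le n$ and $1\le k<t_i$ with $\gcd(k,t_i)=1$, $\theta_i^k$ is the automorphism of $\mathbb W$ with $\theta_i^k(w_j)=w_j$ for $j\ne i$ and $\theta_i^k(w_i)=w_1(w_1w_i)^k$. Let $C_i=\langle\theta_i^k : 1\le k<t_i,\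 \gcd(k,t_i)=1\rangle\cong \operatorname{U}_{t_i}$ and $C=C_2\times\cdots\times C_n\le\operatorname{Aut}(\mathbb W)$. $\widehat{w_1}$ is the inner automorphism $x\mapsto w_1xw_1$. $G$ is the group of graph automorphisms: the automorphisms $\tilde\alpha$ of $\mathbb W$ with $\tilde\alpha(w_1)=w_1$ and $\tilde\alpha(w_i)=w_{\alpha(i)}$ ($2\le i\le n$), where $\alpha$ ranges over permutations of $\{2,\dots,n\}$ with $\alpha(A_j)=A_j$ for all $j$. *)

(* Defs.v *)
From HB Require Import structures.
From mathcomp Require Import all_boot monoid.
Set Implicit Arguments. Unset Strict Implicit. Unset Printing Implicit Defensive.

Local Open Scope group_scope.

Definition is_hom (G H : groupType) (f : G -> H) : Prop :=
  forall x y, f (x * y) = f x * f y.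

Definition is_aut (W : groupType) (f : W -> W) : Prop :=
  is_hom f /\ bijective f.

Definition star_rel (G : groupType) (n : nat) (t : nat -> nat) (w : nat -> G) :=
  (forall j, (1 <= j <= n)%N -> w j * w j = 1) /\
  (forall i, (2 <= i <= n)%N -> (w 1%N * w i) ^+ t i = 1).

Definition presents (W : groupType) (n : nat) (t : nat -> nat) (w : nat -> W) :=
  star_rel n t w /\
  forall (H : groupType) (h : nat -> H), star_rel n t h ->
    exists f : W -> H, [/\ is_hom f,
      (forall j, (1 <= j <= n)%N -> f (w j) = h j) &
      (forall g : W -> H, is_hom g -> (forall j, (1 <= j <= n)%N -> g (w j) = h j) ->
         forall x, g x = f x)].

(* block A_j (1 <= j <= l) of {2..n}, of size k j *)
Definition inA (k : nat -> nat) (j i : nat) : bool :=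
  (2 + \sum_(1 <= r < j) k r <= i < 2 + \sum_(1 <= r < j.+1) k r)%N.

Definition autset (W : groupType) := (W -> W) -> Prop.

Definition inv_of (W : groupType) (f g : W -> W) := cancel f g /\ cancel g f.

Definition aut_subgroup (W : groupType) (P : autset W) : Prop :=
  [/\ forall f, P f -> is_aut f,
      forall f g, P f -> f =1 g -> P g,
      P id,
      forall f g, P f -> P g -> P (f \o g) &
      forall f g, P f -> inv_of f g -> P g].

Definition Aut (W : groupType) : autset W := fun f => is_aut f.

Definition fsubset (W : groupType) (P Q : autset W) := forall f, P f -> Q f.
Definition fseteq (W : groupType) (P Q : autset W) := forall f, P f <-> Q f.

Definition gen (W : groupType) (S : autset W) : autset W :=
  fun f => forall P, aut_subgroup P -> fsubset S P -> P f.

Definition aprod (W : groupType) (P Q : autset W) : autset W :=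
  fun f => exists g h, [/\ P g, Q h & f =1 g \o h].

Definition trivInt (W : groupType) (P Q : autset W) :=
  forall f, P f -> Q f -> f =1 id.

Definition normalized (W : groupType) (N K : autset W) :=
  forall k k' f, K k -> inv_of k k' -> N f -> N (k \o f \o k').

Definition sdprod_int (W : groupType) (N H K : autset W) :=
  [/\ aut_subgroup N /\ aut_subgroup H, aut_subgroup K,
      fsubset N K /\ normalized N K, trivInt N H & fseteq K (aprod N H)].

Definition Inn (W : groupType) : autset W :=
  fun f => exists g : W, forall x, f x = g^-1 * x * g.

Definition hat (W : groupType) (a : W) : W -> W := fun x => a * x * a.
Definition cyc (W : groupType) (g : W -> W) : autset W := gen (fun f => f =1 g).

Definition theta_set (W : groupType) (n : nat) (t : nat -> nat) (w : nat -> W)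
    (i : nat) : autset W :=
  fun f => exists kk, [/\ (1 <= kk < t i)%N, coprime kk (t i), is_aut f,
    (forall j, (1 <= j <= n)%N -> j != i -> f (w j) = w j) &
    f (w i) = w 1%N * (w 1%N * w i) ^+ kk].

(* C_i and C = C_2 x ... x C_n (internal, generated by all the C_i) *)
Definition Ci (W : groupType) n t (w : nat -> W) i : autset W := gen (theta_set n t w i).
Definition Cgrp (W : groupType) n t (w : nat -> W) : autset W :=
  gen (fun f => exists i, (2 <= i <= n)%N /\ Ci n t w i f).

Definition Ggrp (W : groupType) (n l : nat) (k : nat -> nat) (w : nat -> W) : autset W :=
  fun f => exists alpha : nat -> nat,
    [/\ forall i, (2 <= i <= n)%N -> (2 <= alpha i <= n)%N,
        forall i i', (2 <= i <= n)%N -> (2 <= i' <= n)%N -> alpha i = alpha i' -> i = i',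
        forall j i, (1 <= j <= l)%N -> inA k j i -> inA k j (alpha i),
        (is_aut f /\ f (w 1%N) = w 1%N) &
        forall i, (2 <= i <= n)%N -> f (w i) = w (alpha i)].

(* Main.v *)
(** Put x_i = w_1 w_i. As every t_i is odd, W = F x| <w_1> with F the free product
    of the cyclic groups <x_i> of order t_i, and w_1 inverts every x_i. If y in F is
    inverted by w_1, comparing the normal forms of y^-1 and w_1 y w_1 shows that the
    normal form of y is a palindrome. Hence
    - an involution y w_1 is conjugate to w_1: peel off equal outer syllables, and
      halve the exponent of the middle one;
    - if y has finite order, then y is a single syllable, since two outer syllables
      x_i^a would merge to x_i^(2a) <> 1 in the powers of y;
    - the centralizer of w_1 is {1, w_1}.
    So up to an inner automorphism every automorphism fixes w_1 and maps each x_i to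
    a power of some x_(s i), which gives Aut W = Inn W . C . G with
    Inn W /\ C = <hat w_1>. A complement D of <hat w_1> in C is the kernel of the
    quadratic character mod p of the exponent at an index i with p | t_i; that
    character takes the value -1 at hat w_1, because p = 3 mod 4. *)

Require Import Defs.
From HB Require Import structures.
From mathcomp Require Import all_boot monoid cyclic.
From mathcomp Require Import zify.

Set Implicit Arguments.
Unset Strict Implicit.
Unset Printing Implicit Defensive.

Local Open Scope group_scope.

(** * Reduced words and the model of the star group *)

Section ReducedWords.

Variables (n : nat) (t : nat -> nat).
Implicit Types (p q : nat * nat) (s z u : seq (nat * nat)).

(* A pair (i, a) stands for x_i^a. *)
Definition syllable p := ((2 <= p.1 <= n) && (0 < p.2 < t p.1))%N.
Definition index_neq p q := p.1 != q.1.
Definition reduced s := all syllable s && sorted index_neq s.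

(** Addition of residues modulo [T]; the single conditional subtraction keeps the later case
    analyses linear. *)
Definition addmod (T a b : nat) := (if a + b < T then a + b else a + b - T)%N.

Lemma addmod_small T a b : (a + b < T)%N -> addmod T a b = (a + b)%N.
Proof. by rewrite /addmod => ->. Qed.

Lemma addmod_full T a b : (a + b = T)%N -> addmod T a b = 0%N.
Proof. by rewrite /addmod => ->; rewrite ltnn subnn. Qed.

(** Left multiplication of a normal form by one syllable. Iterated in [act], it is van der Waerden's
    action, which turns reduced words into the free product of the cyclic groups. *)
Definition glue p s :=
  if s is q :: s' then
    if p.1 == q.1 then
      let c := addmod (t p.1) p.2 q.2 in
      if c == 0%N then s' else (p.1, c) :: s'
    else p :: s
  else [:: p].

Definition act s z := foldr glue z s.

Definition sinv p := (p.1, t p.1 - p.2)%N.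
(** Exponents are negated but the order is kept: this is conjugation by [w_1]. Inversion in the free
    product is [rev (winv s)]. *)
Definition winv s := map sinv s.

Lemma reduced_cons p s :
  reduced (p :: s) = [&& syllable p, path index_neq p s & reduced s].
Proof.
rewrite /reduced; case: s => [|q s] /=; first by rewrite !andbT.
by case: (syllable p); case: (index_neq p q); rewrite /= ?andbF //;
  case: (path _ q s); rewrite ?andbT ?andbF.
Qed.

Lemma reduced_behead p s : reduced (p :: s) -> reduced s.
Proof. by rewrite reduced_cons => /and3P[]. Qed.

Lemma reduced_syllable p s : reduced (p :: s) -> syllable p.
Proof. by rewrite reduced_cons => /and3P[]. Qed.

Lemma glue_path p s : path index_neq p s -> glue p s = p :: s.
Proof. by case: s => [|q s] //= /andP[/negbTE ->]. Qed.

Lemma path_index p p' s : p.1 = p'.1 -> path index_neq p s = path index_neq p' s.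
Proof. by case: s => //= q s; rewrite /index_neq => ->. Qed.

Lemma reduced_glue p s : syllable p -> reduced s -> reduced (glue p s).
Proof.
move=> vp; case: s => [|q s]; first by rewrite reduced_cons vp.
move=> rs; have := rs; rewrite reduced_cons => /and3P[vq pq rs'] /=.
case: eqP => [e|/eqP ne]; last by rewrite reduced_cons vp rs /= /index_neq ne pq.
case: eqP => // c0; rewrite reduced_cons rs' andbT (path_index (p' := q)) // pq andbT.
move: vp vq c0; rewrite /syllable /addmod /= -e => /andP[-> /=] ? /andP[_].
case: ifP; lia.
Qed.

Lemma reduced_act s z : reduced s -> reduced z -> reduced (act s z).
Proof.
move=> + rz; elim: s => // p s IH rs /=.
by apply: reduced_glue (reduced_syllable rs) (IH (reduced_behead rs)).
Qed.

Lemma pair_eq1 p q : p.1 = q.1 -> p.2 = q.2 -> p = q.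
Proof. by case: p q => [? ?] [? ?] /= -> ->. Qed.

(** The heart of associativity: when [s] starts at the same index too, three exponents are added
    modulo [t], and the cases record which partial sums vanish. *)
Lemma glueA p q s : syllable p -> syllable q -> p.1 = q.1 -> reduced s ->
  glue p (glue q s) =
  if addmod (t p.1) p.2 q.2 == 0%N then s
  else glue (p.1, addmod (t p.1) p.2 q.2) s.
Proof.
move=> vp vq e rs; case: s rs => [|r s] rs /=; first by rewrite e eqxx.
rewrite -e; have := rs; rewrite reduced_cons => /and3P[vr pr rs'].
case: eqP => [er|ner]; last by rewrite /= -e eqxx.
move: vp vq vr; rewrite /syllable -er -e => /andP[_ vp] /andP[_ vq] /andP[_ vr].
case: eqP => c0.
  rewrite glue_path ?(path_index (p' := r)) //.
  case: eqP => d0.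
    congr (_ :: _); apply: pair_eq1 => //.
    by move: c0 d0; rewrite /addmod; do 2! case: ifP; lia.
  have -> : addmod (t p.1) (addmod (t p.1) p.2 q.2) r.2 = p.2.
    by move: c0 d0; rewrite /addmod; do 3! case: ifP; lia.
  by case: eqP => [|_]; [lia | case: (p) ].
rewrite /= eqxx.
have A : addmod (t p.1) p.2 (addmod (t p.1) q.2 r.2) =
    addmod (t p.1) (addmod (t p.1) p.2 q.2) r.2.
  by move: c0; rewrite /addmod; do 4! case: ifP; lia.
rewrite A; case: (addmod (t p.1) p.2 q.2 =P 0%N) A => // -> _.
have -> : addmod (t p.1) 0 r.2 = r.2 by rewrite /addmod; case: ifP; lia.
by case: eqP => [|_]; [lia | congr (_ :: _); apply: pair_eq1].
Qed.

Lemma act_glue p s u : syllable p -> reduced s -> reduced u ->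
  act (glue p s) u = glue p (act s u).
Proof.
move=> vp rs ru; case: s rs => [|q s] //= rs.
case: eqP => // e; rewrite glueA ?(reduced_syllable rs) //.
  by case: ifP.
exact: reduced_act (reduced_behead rs) ru.
Qed.

Lemma actA s z u : reduced s -> reduced z -> reduced u ->
  act (act s z) u = act s (act z u).
Proof.
move=> + rz ru; elim: s => //= p s IH rs.
rewrite act_glue ?(reduced_syllable rs) ?IH ?(reduced_behead rs) //.
exact: reduced_act (reduced_behead rs) rz.
Qed.

Lemma act_nil s : reduced s -> act s [::] = s.
Proof.
elim: s => //= p s IH rs; rewrite IH ?(reduced_behead rs) // glue_path //.
by move: rs; rewrite reduced_cons => /and3P[].
Qed.

Lemma sinvK p : syllable p -> sinv (sinv p) = p.
Proof. by case: p => i a; rewrite /syllable /sinv /= => h; congr (_, _); lia. Qed.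

Lemma winvK s : all syllable s -> winv (winv s) = s.
Proof. by elim: s => //= p s IH /andP[vp /IH ->]; rewrite sinvK. Qed.

Lemma syllable_sinv p : syllable p -> syllable (sinv p).
Proof. by case: p => i a; rewrite /syllable /sinv /=; lia. Qed.

Lemma reduced_winv s : reduced s -> reduced (winv s).
Proof.
rewrite /reduced => /andP[vs ss]; apply/andP; split.
  by rewrite all_map; apply: sub_all vs => p; apply: syllable_sinv.
by rewrite sorted_map (eq_sorted (e' := index_neq)).
Qed.

Lemma reduced_rev s : reduced (rev s) = reduced s.
Proof.
rewrite /reduced all_rev rev_sorted; congr (_ && _).
by apply: eq_sorted => p q /=; rewrite /index_neq eq_sym.
Qed.

Lemma winv_glue p s : syllable p -> reduced s ->
  winv (glue p s) = glue (sinv p) (winv s).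
Proof.
move=> vp; case: s => //= q s /reduced_syllable vq.
case: eqP => //= e; move: vp vq; rewrite /syllable -e => /andP[_ vp] /andP[_ vq].
have -> : (addmod (t p.1) (t p.1 - p.2) (t p.1 - q.2) == 0%N)
    = (addmod (t p.1) p.2 q.2 == 0%N).
  by rewrite /addmod; do 2! case: ifP; lia.
case: eqP => //= d0; congr ((_, _) :: _).
by move: d0; rewrite /addmod /=; do 2! case: ifP; lia.
Qed.

Lemma winv_act s z : reduced s -> reduced z ->
  winv (act s z) = act (winv s) (winv z).
Proof.
move=> + rz; elim: s => //= p s IH rs.
rewrite winv_glue ?(reduced_syllable rs) ?IH ?(reduced_behead rs) //.
exact: reduced_act (reduced_behead rs) rz.
Qed.

Lemma act_rev_winv s : reduced s -> act (rev (winv s)) s = [::].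
Proof.
elim: s => //= p s IH rs; rewrite rev_cons /act -cats1 foldr_cat /= eqxx.
have -> : addmod (t p.1) (t p.1 - p.2) p.2 = 0%N.
  have /andP[_] := reduced_syllable rs.
  by rewrite /addmod; case: ifP; lia.
by rewrite eqxx; apply: IH (reduced_behead rs).
Qed.

(** * The semidirect product with [w_1] *)

Definition twist (e : bool) s := if e then winv s else s.

Lemma reduced_twist e s : reduced s -> reduced (twist e s).
Proof. by case: e => //; apply: reduced_winv. Qed.

Lemma twist_act e s z : reduced s -> reduced z ->
  twist e (act s z) = act (twist e s) (twist e z).
Proof. by case: e => //; apply: winv_act. Qed.

Lemma twist_twist e e' s : reduced s -> twist e (twist e' s) = twist (e (+) e') s.
Proof. by case: e; case: e' => //= /andP[vs _]; rewrite winvK. Qed.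

(* The pair (s, e) stands for s w_1^e. *)
Record star_word := StarWord {
  word_pair : seq (nat * nat) * bool;
  word_reduced : reduced word_pair.1 }.

HB.instance Definition _ := [isSub for word_pair].
HB.instance Definition _ := [Choice of star_word by <:].

Implicit Types x y : star_word.

Fact sw_mul_proof x y : reduced (act (val x).1 (twist (val x).2 (val y).1)).
Proof. by rewrite reduced_act ?reduced_twist ?word_reduced. Qed.
(** The semidirect product law: [w_1 ^ e] passes the second word by [twist e], and the exponents of
    [w_1] add modulo 2. *)
Definition sw_mul x y :=
  @StarWord (act (val x).1 (twist (val x).2 (val y).1), (val x).2 (+) (val y).2)
    (sw_mul_proof x y).

Fact sw_inv_proof x : reduced (twist (val x).2 (rev (winv (val x).1))).
Proof. by rewrite reduced_twist // reduced_rev reduced_winv ?word_reduced. Qed.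
Definition sw_inv x :=
  @StarWord (twist (val x).2 (rev (winv (val x).1)), (val x).2) (sw_inv_proof x).

Definition sw_one := @StarWord ([::], false) isT.

Lemma sw_mulA : associative sw_mul.
Proof.
case=> [[s e] rs] [[z e'] rz] [[u e2] ru]; apply: val_inj => /=; congr (_, _).
  rewrite twist_act ?reduced_twist // twist_twist // actA ?reduced_twist //.
by rewrite addbA.
Qed.

Lemma sw_mul1 : left_id sw_one sw_mul.
Proof. by case=> [[s e] rs]; apply: val_inj. Qed.

Lemma sw_1mul : right_id sw_one sw_mul.
Proof.
case=> [[s e] rs]; apply: val_inj; rewrite /= addbF.
by rewrite (_ : twist e [::] = [::]) ?act_nil //; case: (e).
Qed.

Lemma sw_mulV : left_inverse sw_one sw_inv sw_mul.
Proof.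
case=> [[s e] rs]; apply: val_inj; rewrite /= addbb; congr (_, _).
have rs' : reduced (rev (winv s)) by rewrite reduced_rev reduced_winv.
by rewrite -twist_act // act_rev_winv //; case: (e).
Qed.

Lemma sw_mulV' : right_inverse sw_one sw_inv sw_mul.
Proof.
case=> [[s e] rs]; apply: val_inj; rewrite /= addbb; congr (_, _).
have rs' : reduced (rev (winv s)) by rewrite reduced_rev reduced_winv.
rewrite twist_twist // addbb /=.
have := act_rev_winv rs'; rewrite /winv map_rev revK -/(winv _) -/(winv _).
by rewrite winvK //; case/andP: rs.
Qed.

HB.instance Definition _ :=
  isGroup.Build star_word sw_mulA sw_mul1 sw_1mul sw_mulV sw_mulV'.

End ReducedWords.

(** * Normal forms in a star group *)

Section Homomorphisms.

Variables (G H : groupType) (f : G -> H).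
Hypothesis fM : is_hom f.

Lemma hom1 : f 1 = 1.
Proof. by apply: (mulgI (f 1)); rewrite -fM !mulg1. Qed.

Lemma homX x k : f (x ^+ k) = f x ^+ k.
Proof. by elim: k => [|k IH]; rewrite ?hom1 // !expgS fM IH. Qed.

Lemma homV x : f x^-1 = (f x)^-1.
Proof. by apply: (mulgI (f x)); rewrite -fM !mulgV hom1. Qed.

End Homomorphisms.

Lemma hom_comp (G H K : groupType) (f : G -> H) (g : H -> K) :
  is_hom f -> is_hom g -> is_hom (g \o f).
Proof. by move=> fM gM x y /=; rewrite fM gM. Qed.

Lemma expg_mod (G : groupType) (x : G) T a : x ^+ T = 1 -> x ^+ (a %% T) = x ^+ a.
Proof.
by move=> xT; rewrite {2}(divn_eq a T) expgnDr mulnC expgnA xT expg1n mul1g.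
Qed.

(** Modulo [p] this is [(-1) ^ h = -1]; it will evaluate the quadratic character at [hat w_1]. *)
Lemma dvdn_odd_expS a p h : odd h -> p %| a.+1 -> p %| (a ^ h).+1.
Proof.
move=> oh; rewrite -(odd_double_half h) oh add1n => p_a.
elim: (h./2) => [|q IH]; first by rewrite expn1.
have : p %| (a * a * (a ^ (q.*2).+1).+1 + a.+1) by rewrite dvdn_add ?dvdn_mull.
have -> : (a * a * (a ^ (q.*2).+1).+1 + a.+1 = (a ^ (q.+1.*2).+1).+1 + a * a.+1)%N.
  by rewrite doubleS !expnS; nia.
by rewrite dvdn_addl // dvdn_mull.
Qed.

Section NormalForms.

Variables (n : nat) (t : nat -> nat) (W : groupType) (w : nat -> W).
Hypothesis n_gt0 : (0 < n)%N.
Hypothesis t_odd : forall i, (2 <= i <= n)%N -> odd (t i).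
Hypothesis t_gt2 : forall i, (2 <= i <= n)%N -> (2 < t i)%N.
Hypothesis presW : presents n t w.

Local Notation w1 := (w 1%N).
Local Notation X i := (w 1%N * w i).
Local Notation rng i := (2 <= i <= n)%N.
Local Notation reduced := (reduced n t).
Local Notation syllable := (syllable n t).
Local Notation winv := (winv t).

Lemma range_w j : (1 <= j <= n)%N -> j = 1%N \/ rng j.
Proof. lia. Qed.

Lemma hom_ext (H : groupType) (f g : W -> H) : is_hom f -> is_hom g ->
  f w1 = g w1 -> (forall i, rng i -> f (X i) = g (X i)) -> f =1 g.
Proof.
move=> fM gM e1 eX; have ew j : (1 <= j <= n)%N -> f (w j) = g (w j).
  case/range_w=> [-> //|rj]; apply: (mulgI (f w1)).
  by rewrite -fM eX // gM e1.
have [[ww wt] univ] := presW.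
have [|f0 [_ _ u]] := univ H (fun j => g (w j)).
  split=> [j rj|i ri]; first by rewrite -gM ww // hom1.
  by rewrite -gM -homX // wt // hom1.
by move=> x; rewrite u // [RHS]u.
Qed.

Lemma w1K : w1 * w1 = 1.
Proof. by case: presW => -[ww _] _; apply: ww; lia. Qed.

Lemma w1V : w1^-1 = w1.
Proof. by apply: mulg1_eq w1K. Qed.

Lemma w1KA x : w1 * (w1 * x) = x.
Proof. by rewrite mulgA w1K mul1g. Qed.

Lemma XT i : rng i -> X i ^+ t i = 1.
Proof. by case: presW => -[_ wt] _; apply: wt. Qed.

Lemma hatM : is_hom (hat w1).
Proof. by move=> x y; rewrite /hat -!mulgA w1KA. Qed.

Lemma hatK : involutive (hat w1).
Proof. by move=> x; rewrite /hat -!mulgA w1K mulg1 w1KA. Qed.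

Lemma hat_X i : rng i -> hat w1 (X i) = (X i)^-1.
Proof.
move=> ri; rewrite /hat w1KA; apply/esym/mulg1_eq.
rewrite mulgA -(mulgA w1).
by case: presW => -[ww _] _; rewrite ww ?mulg1 ?w1K //; lia.
Qed.

Lemma hat_w1 : hat w1 w1 = w1.
Proof. by rewrite /hat w1K mul1g. Qed.

Lemma w1_hat x : w1 * x = hat w1 x * w1.
Proof. by rewrite /hat -!mulgA w1K mulg1. Qed.

Lemma XV i a : rng i -> (a <= t i)%N -> X i ^+ (t i - a) = X i ^- a.
Proof. by move=> ri le_a; rewrite expgnFr // XT // mul1g. Qed.

Lemma X_addmod i a b : rng i -> X i ^+ addmod (t i) a b = X i ^+ a * X i ^+ b.
Proof.
move=> ri; rewrite /addmod -expgnDr; case: ltnP => // le_t.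
by rewrite expgnFr // XT // divg1.
Qed.

Definition eval s := foldr (fun p x => X p.1 ^+ p.2 * x) 1 s.

Lemma eval_cat s z : eval (s ++ z) = eval s * eval z.
Proof. by elim: s => [|p s IH] /=; rewrite ?mul1g // IH mulgA. Qed.

Lemma syllable_rng p : syllable p -> rng p.1.
Proof. by case/andP. Qed.

Lemma eval_winv s : all syllable s -> eval (winv s) = hat w1 (eval s).
Proof.
elim: s => [|p s IH] /=; first by rewrite (hom1 hatM).
case/andP=> vp /IH ->; rewrite hatM (homX hatM) hat_X ?syllable_rng //.
by rewrite expVgn XV ?syllable_rng //; case/andP: vp => _ /andP[_ /ltnW].
Qed.

Lemma eval_rev_winv s : all syllable s -> eval (rev (winv s)) = (eval s)^-1.
Proof.
elim: s => [|p s IH] /=; first by rewrite invg1.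
case/andP=> vp /IH; rewrite rev_cons -cats1 eval_cat => -> /=.
rewrite mulg1 invgM XV ?syllable_rng //; case/andP: vp => _ /andP[_ /ltnW//].
Qed.

Lemma eval_glue p s : syllable p -> eval (glue t p s) = X p.1 ^+ p.2 * eval s.
Proof.
move=> vp; case: s => //= q s; case: eqP => //= e.
have := @X_addmod p.1 p.2 q.2 (syllable_rng vp).
by rewrite mulgA -e; case: eqP => [->|_] <-; rewrite /= ?expg0 ?mul1g.
Qed.

Lemma eval_act s z : all syllable s -> eval (act t s z) = eval s * eval z.
Proof.
elim: s => [|p s IH] /=; first by rewrite mul1g.
by case/andP=> vp /IH IHs; rewrite eval_glue // IHs mulgA.
Qed.

Lemma eval_twist e s : all syllable s ->
  w1 ^+ (e : bool) * eval s = eval (twist t e s) * w1 ^+ e.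
Proof.
by case: e => /= vs; rewrite ?expg0 ?expg1 ?mul1g ?mulg1 // w1_hat eval_winv.
Qed.

Definition sw_syl (j a : nat) : star_word n t :=
  insubd (1 : star_word n t) ([:: (j, a)], false).
Definition sw_flip : star_word n t := @StarWord n t ([::], true) isT.
Definition sw_gen j := if j == 1%N then sw_flip else sw_flip * sw_syl j 1.

Lemma val_sw_mul (x y : star_word n t) :
  val (x * y) = (act t (val x).1 (twist t (val x).2 (val y).1), (val x).2 (+) (val y).2).
Proof. by []. Qed.

Lemma val_sw_syl j a : syllable (j, a) -> val (sw_syl j a) = ([:: (j, a)], false).
Proof. by move=> v; rewrite insubdK // unfold_in /= reduced_cons v. Qed.

Lemma sw_syl1 j : rng j -> syllable (j, 1%N).
Proof. by move=> rj; rewrite /syllable /= rj /=; have := t_gt2 rj; lia. Qed.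

Lemma sw_sylX j a : rng j -> (0 < a < t j)%N -> sw_syl j 1 ^+ a = sw_syl j a.
Proof.
move=> rj; elim: a => [|[|a] IH] // lt_a.
rewrite expgS IH; last lia; apply: val_inj.
rewrite val_sw_mul !val_sw_syl ?sw_syl1 //=; try by rewrite /syllable /= rj /=; lia.
by rewrite eqxx addmod_small ?add1n //; lia.
Qed.

Lemma star_rel_model : star_rel n t sw_gen.
Proof.
have flipK : sw_flip * sw_flip = 1 by apply: val_inj.
split=> [j rj|i ri]; rewrite /sw_gen /=.
  case: eqP => // ne; have {}rj : rng j by lia.
  have tj := t_gt2 rj.
  (* [(w_1 x_j)(w_1 x_j) = x_j^-1 x_j]: the exponents [t j - 1] and [1] merge to 0. *)
  apply: val_inj; rewrite !val_sw_mul val_sw_syl ?sw_syl1 //= eqxx.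
  by rewrite addmod_full //; lia.
rewrite (_ : (i == 1%N) = false) ?mulgA ?flipK ?mul1g; last lia.
(* One factor is split off because only exponents below [t i] are syllables. *)
have ti := t_gt2 ri; rewrite -(prednK (_ : 0 < t i)%N); last lia.
rewrite expgS sw_sylX //; last lia; apply: val_inj.
rewrite val_sw_mul !val_sw_syl ?sw_syl1 //=; try by rewrite /syllable /= ri /=; lia.
by rewrite eqxx addmod_full //; lia.
Qed.

Definition sw_eval (x : star_word n t) := eval (val x).1 * w1 ^+ (val x).2.

Lemma sw_evalM : is_hom sw_eval.
Proof.
move=> [[s e] /= rs] [[z d] /= rz]; rewrite /sw_eval val_sw_mul /=.
have /andP[vs _] := rs; have /andP[vz _] := rz.
rewrite eval_act // -!mulgA (mulgA (w1 ^+ e)) eval_twist // -mulgA; congr (_ * (_ * _)).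
by case: e {rs}; case: d {rz}; rewrite ?expg0 ?expg1 ?mul1g ?mulg1 ?w1K.
Qed.

(** The universal property maps [W] to the model, and [sw_eval] maps back. The composite fixes the
    generators, so every element is the value of its normal form; computing the image of a reduced
    word gives uniqueness. *)
Lemma normal_forms : exists nf : W -> seq (nat * nat) * bool,
  [/\ forall x, reduced (nf x).1,
      forall x, x = eval (nf x).1 * w1 ^+ (nf x).2,
      forall s e, reduced s -> nf (eval s * w1 ^+ (e : bool)) = (s, e) &
      forall x y, (nf (x * y)).2 = (nf x).2 (+) (nf y).2].
Proof.
have [_ /(_ _ _ star_rel_model)[f [fM fw _]]] := presW.
have f1 : f w1 = sw_flip by rewrite fw //; lia.
have fX i : rng i -> f (X i) = sw_syl i 1.
  move=> ri; rewrite fM f1 fw; last lia.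
  rewrite /sw_gen (_ : (i == 1%N) = false); last lia.
  by rewrite mulgA (_ : sw_flip * sw_flip = 1) ?mul1g //; apply: val_inj.
exists (fun x => val (f x)); split=> [x|x|s e rs|x y].
- exact: word_reduced.
- apply/esym; apply: (hom_ext (f := sw_eval \o f) (g := id)) => //.
  + exact: hom_comp sw_evalM.
  + by rewrite /= f1 /sw_eval /= mul1g.
  + by move=> i ri /=; rewrite fX // /sw_eval val_sw_syl ?sw_syl1 //= !mulg1.
- have fs : val (f (eval s)) = (s, false).
    elim: s rs => [|p s IH] rs /=; first by rewrite hom1.
    have /andP[rp ap] := reduced_syllable rs.
    rewrite fM homX // fX // sw_sylX // val_sw_mul IH ?(reduced_behead rs) //.
    rewrite val_sw_syl -?surjective_pairing /= ?(reduced_syllable rs) //.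
    by rewrite glue_path //; move: rs; rewrite reduced_cons => /and3P[].
  rewrite fM val_sw_mul fs homX // f1 /=; by case: e; rewrite /= (act_nil rs).
- by rewrite fM.
Qed.

Lemma normal_form x : exists s (e : bool), reduced s /\ x = eval s * w1 ^+ e.
Proof.
by have [nf [nf_red nfE _ _]] := normal_forms; exists (nf x).1, (nf x).2.
Qed.

Lemma eval_inj s z (e d : bool) : reduced s -> reduced z ->
  eval s * w1 ^+ e = eval z * w1 ^+ d -> s = z /\ e = d.
Proof.
have [nf [_ _ nfK _]] := normal_forms => rs rz /(congr1 nf).
by rewrite !nfK // => -[].
Qed.

Lemma eval_inj0 s z : reduced s -> reduced z -> eval s = eval z -> s = z.
Proof.
by move=> rs rz e; case: (@eval_inj s z false false) => //; rewrite e.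
Qed.

(** The parity is the exponent of [w_1] in the normal form; its kernel is the free product F. *)
Lemma parity_hom : exists par : W -> bool,
  [/\ {morph par : x y / x * y >-> x (+) y}, par w1 = true,
      forall i, rng i -> par (X i) = false &
      forall x, par x = false -> exists2 s, reduced s & x = eval s].
Proof.
have [nf [nf_red nfE nfK nfM]] := normal_forms.
exists (fun x => (nf x).2); split=> //.
- by have := nfK [::] true isT; rewrite /= mul1g expg1 => ->.
- move=> i ri; have := nfK [:: (i, 1%N)] false.
  by rewrite /= expg0 !mulg1 expg1 => -> //; rewrite reduced_cons sw_syl1.
move=> x px; exists (nf x).1 => //.
by rewrite [LHS]nfE px expg0 mulg1.
Qed.

Lemma odd_order_eval x T : odd T -> x ^+ T = 1 -> exists2 s, reduced s & x = eval s.
Proof.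
move=> oT xT; have [par [parM _ _ par_eval]] := parity_hom.
apply: par_eval; have p1 : par 1 = false.
  by have := parM 1 1; rewrite mulg1; case: (par 1).
have parX k : par (x ^+ k) = odd k && par x.
  by elim: k => [|k IH]; rewrite ?expg0 // expgS parM IH /=; case: (par x) (odd k) => [] [].
by have := parX T; rewrite xT p1 oT.
Qed.

(** The images of the [x_i] have odd order, hence even parity. Were [f w_1] even too, the whole
    image of [f] would be even, while it contains [w_1]. *)
Lemma hom_w1_odd (f : W -> W) : is_hom f -> (exists x, f x = w1) ->
  exists2 s, reduced s & f w1 = eval s * w1.
Proof.
move=> fM [x fx]; have [par [parM par1 parX par_eval]] := parity_hom.
have p1 : par 1 = false by have := parM 1 1; rewrite mulg1; case: (par 1).
case pf: (par (f w1)).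
  have [|s rs es] := par_eval (f w1 * w1); first by rewrite parM pf par1.
  by exists s; rewrite // -es -mulgA w1K mulg1.
have pfX i a : rng i -> par (f (X i) ^+ a) = false.
  move=> ri; have [||s rs ->] := @odd_order_eval (f (X i)) (t i).
  - exact: t_odd.
  - by rewrite -homX // XT // hom1.
  elim: a => [|a IH]; first by rewrite expg0.
  rewrite expgS parM {}IH addbF; case/andP: rs => vs _; elim: s vs => //= p s IH.
  case/andP=> vp /IH; rewrite parM => ->; rewrite addbF.
  elim: (p.2) => [|b IHb]; first by rewrite expg0.
  by rewrite expgS parM IHb parX // (syllable_rng vp).
have [s [e [/andP[vs _] ex]]] := normal_form x.
have : par (f x) = false; last by rewrite fx par1.
rewrite ex fM homX // parM; case: e {ex}; rewrite ?expg0 ?expg1 ?pf ?p1 addbF;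
  by elim: s vs => [|p s IH] /=; [rewrite hom1 |
    case/andP=> vp /IH; rewrite fM parM homX // pfX // (syllable_rng vp)].
Qed.

(** * Palindromic normal forms *)

(** The conjugate [winv s] and the inverse [rev (winv s)] are both reduced, so uniqueness of normal
    forms makes them equal as words. *)
Lemma eval_palindrome s : reduced s -> hat w1 (eval s) = (eval s)^-1 -> rev s = s.
Proof.
move=> rs; have /andP[vs _] := rs.
rewrite -eval_winv // -eval_rev_winv // => /eval_inj0 ws.
have {}ws : winv s = rev (winv s).
  by apply: ws; rewrite ?reduced_rev reduced_winv.
have := congr1 (map (sinv t)) ws; rewrite map_rev -!/(winv _) (winvK vs).
by move=> {2}->.
Qed.

Lemma conj_palindrome s : reduced s -> rev s = s ->
  exists g, eval s * w1 = g * w1 * g^-1.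
Proof.
move: {2}(size s) (leqnn (size s)) => k; elim: k s => [|k IH] s.
  by rewrite leqn0 => /nilP-> _ _; exists 1; rewrite /= !mul1g invg1 mulg1.
case: s => [|p s]; first by move=> *; exists 1; rewrite /= !mul1g invg1 mulg1.
case/lastP: s => [|s q] /= le_s rs pal.
  have rp := syllable_rng (reduced_syllable rs).
  (* As [t p.1] is odd, one of [p.2] and [p.2 + t p.1] is even; its half [b] halves the exponent
     modulo [t p.1]. *)
  pose b := (if odd p.2 then (p.2 + t p.1)./2 else p.2./2)%N.
  have eb : X p.1 ^+ p.2 = X p.1 ^+ b * X p.1 ^+ b.
    rewrite -expgnDr; have [->|->] : (b + b = p.2 + t p.1 \/ b + b = p.2)%N; last by [].
      by have := t_odd rp; rewrite /b; case: ifP => ? ?; [left | right]; lia.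
    by rewrite expgnDr XT ?mulg1.
  exists (X p.1 ^+ b); rewrite mulg1 eb -!mulgA; congr (_ * _).
  by rewrite (w1_hat _^-1) (homV hatM) (homX hatM) hat_X // expVgn invgK.
move: pal; rewrite rev_cons rev_rcons /= => -[eq].
rewrite {}eq => /rcons_inj[pal].
have rs' : reduced s.
  have := reduced_behead rs; rewrite -reduced_rev rev_rcons => /reduced_behead.
  by rewrite reduced_rev.
case: (IH s) => // [|g eg]; first by move: le_s; rewrite size_rcons; lia.
have rp := syllable_rng (reduced_syllable rs).
(* [x^a y x^a w_1 = x^a (y w_1) x^-a], because [w_1] inverts [x^a]. *)
exists (X p.1 ^+ p.2 * g).
rewrite -cats1 eval_cat /= mulg1 -!mulgA; congr (_ * _).
rewrite invgM !mulgA -eg -!mulgA; congr (_ * _).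
by rewrite (w1_hat _^-1) (homV hatM) (homX hatM) hat_X // expVgn invgK.
Qed.

Lemma involution_conj x s : x = eval s * w1 -> reduced s -> x * x = 1 ->
  exists g, x = g * w1 * g^-1.
Proof.
move=> -> rs xx; apply: conj_palindrome (rs) _; apply: eval_palindrome => //.
by apply/esym/mulg1_eq; rewrite /hat !mulgA; move: xx; rewrite !mulgA.
Qed.

(** Commuting with [w_1] forces [winv s = s]; a first syllable would have exponent [t / 2],
    impossible for odd [t], so the word is empty. *)
Lemma centralizer_w1 g : g * w1 = w1 * g -> g = 1 \/ g = w1.
Proof.
have [s [e [rs ->]]] := normal_form g => cg.
have {cg} : hat w1 (eval s) = eval s.
  rewrite /hat; case: e cg; rewrite ?expg0 ?expg1 ?mulg1.
    by rewrite -!mulgA => <-; rewrite w1K mulg1.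
  by move=> <-; rewrite -mulgA w1K mulg1.
have /andP[vs _] := rs.
rewrite -eval_winv // => /eval_inj0 ws.
have {ws} : winv s = s by apply: ws; rewrite ?reduced_winv.
case: s rs {vs} => [|p s] rs /=; first by case: e; rewrite ?mul1g; [right | left].
have rp := syllable_rng (reduced_syllable rs).
have /andP[_ /andP[p0 pt]] := reduced_syllable rs.
case=> /(congr1 snd) /= ep _; have := t_odd rp.
have -> : t p.1 = p.2.*2 by lia.
by rewrite odd_double.
Qed.

Lemma torsion_palindrome s T : reduced s -> rev s = s -> (0 < T)%N ->
  eval s ^+ T = 1 -> s = [::] \/ exists p, s = [:: p].
Proof.
case: s => [|p s] rs pal; first by left.
right; exists p; case/lastP: s rs pal H H0 => // mid q rs pal T0 sT.
exfalso; move: pal; rewrite rev_cons rev_rcons /= => -[eq _].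
rewrite {}eq in rs sT.
have vp := reduced_syllable rs; have rp := syllable_rng vp.
have /andP[_ tp] := vp.
(* The exponent where two copies of [p] merge, nonzero because [t p.1] is odd. *)
pose c := addmod (t p.1) p.2 p.2.
have c0 : (0 < c < t p.1)%N.
  by have := t_odd rp; rewrite /c /addmod; case: ifP; lia.
(* Each positive power still begins with [p]: in [p mid p] times [p z] the adjacent copies of [p]
   merge into one syllable and nothing else cancels. *)
have claim k : exists2 z, reduced (p :: z) & eval (p :: rcons mid p) ^+ k.+1 = eval (p :: z).
  elim: k => [|k [z rz ez]]; first by exists (rcons mid p); rewrite ?expg1.
  exists (mid ++ (p.1, c) :: z); last first.
    rewrite expgS ez -cats1 /= !eval_cat /= X_addmod // mulg1.
    by rewrite -!mulgA.
  move: rs rz; rewrite /reduced /= !all_rcons !all_cat !rcons_path !cat_path /=.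
  rewrite /syllable /= rp c0 (path_index (p' := p)) //.
  move=> /andP[/andP[-> /andP[_ ->]] /andP[-> lp]] /andP[/andP[_ ->] ->].
  by rewrite /= andbT.
case: T T0 sT => // T _; have [z rz ->] := claim T => e1.
by have := @eval_inj0 (p :: z) [::] rz isT e1.
Qed.

Lemma X_inj i j a b : rng i -> rng j -> X i ^+ a != 1 -> X i ^+ a = X j ^+ b -> i = j.
Proof.
move=> ri rj ne e.
have e' : X i ^+ (a %% t i) = X j ^+ (b %% t j) by rewrite !expg_mod ?XT.
have nea : X i ^+ (a %% t i) != 1 by rewrite expg_mod ?XT.
have neb : X j ^+ (b %% t j) != 1 by rewrite -e'.
have sy k c : rng k -> X k ^+ (c %% t k) != 1 -> reduced [:: (k, c %% t k)%N].
  move=> rk nk; rewrite reduced_cons /syllable /= rk /= !andbT.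
  rewrite ltn_mod; have := t_gt2 rk; case: (c %% t k)%N nk => [|m].
    by rewrite expg0 eqxx.
  lia.
have := @eval_inj0 _ _ (sy i a ri nea) (sy j b rj neb).
by rewrite /= !mulg1 => /(_ e')[].
Qed.

Lemma X_eq1 i a : rng i -> (X i ^+ a == 1) = (t i %| a).
Proof.
move=> ri; apply/eqP/idP => [|/dvdnP[m ->]]; last by rewrite mulnC expgnA XT // expg1n.
rewrite -(expg_mod a (XT ri)) /dvdn => e; apply: contraT => ne.
suff : [:: (i, a %% t i)%N] = [::] by [].
apply: eval_inj0; rewrite //= ?mulg1 // reduced_cons /syllable /= ri /= !andbT.
by rewrite lt0n ne ltn_mod; have := t_gt2 ri; lia.
Qed.

Lemma X_eq i a b : rng i -> (X i ^+ a == X i ^+ b) = (a == b %[mod t i]).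
Proof.
move=> ri; wlog le_ab : a b / (b <= a)%N.
  by move=> h; case/orP: (leq_total a b) => /h //; rewrite eq_sym => ->; rewrite eq_sym.
by rewrite -(subnK le_ab) eqn_mod_dvd ?leq_addl // addnK -X_eq1 // expgnDr -divg_eq1 mulgK.
Qed.

(** * Automorphisms *)

Lemma X_neq1 i : rng i -> X i ^+ 1 != 1.
Proof. by move=> ri; rewrite X_eq1 // gtnNdvd //; have := t_gt2 ri; lia. Qed.

(** The image has odd order and is inverted by [f w_1 = w_1], so its normal form is a palindrome of
    finite order; injectivity rules out the empty word. *)
Lemma fix_w1_X (f : W -> W) i : is_hom f -> injective f -> f w1 = w1 -> rng i ->
  exists j a, [/\ rng j, (0 < a < t j)%N & f (X i) = X j ^+ a].
Proof.
move=> fM f_inj f1 ri.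
have yT : f (X i) ^+ t i = 1 by rewrite -homX // XT // hom1.
have [s rs es] := odd_order_eval (t_odd ri) yT.
have pal : rev s = s.
  apply: eval_palindrome => //; rewrite -es -homV // -hat_X // /hat.
  by rewrite !fM f1.
have ti : (0 < t i)%N by have := t_gt2 ri; lia.
rewrite es in yT *.
case: (torsion_palindrome rs pal ti yT) => [s0|[p sp]].
  have := X_neq1 ri; rewrite -(inj_eq f_inj) expg1 es s0 /= hom1 // eqxx //.
rewrite sp in rs *; have /andP[rp ap] := reduced_syllable rs.
by exists p.1, p.2; rewrite /= mulg1.
Qed.

Lemma inv_of_hom (f g : W -> W) : is_hom f -> inv_of f g -> is_hom g.
Proof. by move=> fM [fK gK] x y; apply: (can_inj fK); rewrite fM !gK. Qed.

Lemma is_aut_inv (f g : W -> W) : is_hom f -> inv_of f g -> is_aut f.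
Proof. by move=> fM [fK gK]; split=> //; exists g. Qed.

Lemma inv_ofC (f g : W -> W) : inv_of f g -> inv_of g f.
Proof. by case. Qed.

Lemma aut_inv (f : W -> W) : is_aut f -> exists g, inv_of f g.
Proof. by move=> [_ [g fK gK]]; exists g. Qed.

Lemma is_aut_comp (f g : W -> W) : is_aut f -> is_aut g -> is_aut (f \o g).
Proof.
move=> [fM fB] [gM gB]; split; last exact: bij_comp.
exact: (hom_comp gM fM).
Qed.

Lemma is_aut_ext (f g : W -> W) : is_aut f -> f =1 g -> is_aut g.
Proof.
move=> [fM fB] fg; split; first by move=> x y; rewrite -!fg.
exact: eq_bij fB _ fg.
Qed.

Lemma is_aut_id : is_aut (@id W).
Proof. by split=> //; exists id. Qed.

Lemma is_aut_subgroup : aut_subgroup (@Aut W).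
Proof.
split=> // [f g|||f g fA fg]; [exact: is_aut_ext|exact: is_aut_id|exact: is_aut_comp|].
by apply: is_aut_inv (inv_of_hom (proj1 fA) fg) (inv_ofC fg).
Qed.

Lemma hat_aut : is_aut (hat w1).
Proof. by split; [exact: hatM | exists (hat w1); exact: hatK]. Qed.

Lemma inv_of_fix (f g : W -> W) : inv_of f g -> f w1 = w1 -> g w1 = w1.
Proof. by move=> [fK _] f1; rewrite -{1}f1 fK. Qed.

(** The inverse sends [x_j] to some [x_k ^ b]. Then [x_i = x_k ^ (b a)], which gives [k = i] and
    [b a = 1] modulo [t i]. *)
Lemma fix_w1_inv_X (f g : W -> W) i j a : is_hom f -> inv_of f g -> f w1 = w1 ->
  rng i -> rng j -> f (X i) = X j ^+ a ->
  [/\ t i = t j, coprime a (t i) & exists b, g (X j) = X i ^+ b].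
Proof.
move=> fM fg f1 ri rj fX; have [fK gK] := fg; have gM := inv_of_hom fM fg.
have [k [b [rk _ gX]]] := fix_w1_X gM (can_inj gK) (inv_of_fix fg f1) rj.
have e : X i ^+ 1 = X k ^+ (b * a) by rewrite expgnA -gX -(homX gM) -fX fK.
have ik := X_inj ri rk (X_neq1 ri) e; subst k.
split; last by exists b.
  apply/eqP; rewrite eqn_dvd -!X_eq1 //; apply/andP; split; apply/eqP.
    by apply: (can_inj fK); rewrite (homX fM) fX -expgnA mulnC expgnA XT // expg1n hom1.
  by apply: (can_inj gK); rewrite (homX gM) gX -expgnA mulnC expgnA XT // expg1n hom1.
move/eqP: e; rewrite X_eq // => /eqP e.
have : coprime (b * a %% t i) (t i) by rewrite -e coprime_modl coprime1n.
by rewrite coprime_modl coprimeMl => /andP[].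
Qed.

(** The proposed image of [w_j] is an involution since [w_1] inverts each [x_i], and equal orders
    preserve the other relations. *)
Lemma monomial_hom (sigma kappa : nat -> nat) :
  (forall i, rng i -> rng (sigma i) /\ t (sigma i) = t i) ->
  exists f : W -> W, [/\ is_hom f, f w1 = w1 &
    forall i, rng i -> f (X i) = X (sigma i) ^+ kappa i].
Proof.
move=> sP; have [_ univ] := presW.
pose h j := if j == 1%N then w1 else w1 * X (sigma j) ^+ kappa j.
have [|f [fM fw _]] := univ W h.
  split=> [j|i ri].
    case/range_w=> [-> |rj]; rewrite /h; first by rewrite /= w1K.
    rewrite (_ : (j == 1%N) = false); last lia.
    rewrite mulgA -/(hat w1 _) (homX hatM) hat_X; last by case: (sP j rj).
    by rewrite expVgn mulVg.
  rewrite /h (_ : (i == 1%N) = false) ?w1KA; last lia.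
  by have [rs <-] := sP i ri; rewrite -expgnA mulnC expgnA XT // expg1n.
have f1 : f w1 = w1 by rewrite fw //; lia.
exists f; split=> // i ri; rewrite fM f1 fw; last lia.
by rewrite /h (_ : (i == 1%N) = false) ?w1KA //; lia.
Qed.

Lemma monomial_aut (sigma sigma' kappa kappa' : nat -> nat) :
  (forall i, rng i -> [/\ rng (sigma i), t (sigma i) = t i, sigma' (sigma i) = i
    & kappa i * kappa' (sigma i) = 1 %[mod t i]]) ->
  (forall i, rng i -> [/\ rng (sigma' i), t (sigma' i) = t i, sigma (sigma' i) = i
    & kappa' i * kappa (sigma' i) = 1 %[mod t i]]) ->
  exists f g : W -> W, [/\ is_hom f, f w1 = w1, inv_of f g,
    forall i, rng i -> f (X i) = X (sigma i) ^+ kappa i &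
    forall i, rng i -> g (X i) = X (sigma' i) ^+ kappa' i].
Proof.
move=> sP sP'.
have [|f [fM f1 fX]] := @monomial_hom sigma kappa; first by move=> i /sP[].
have [|g [gM g1 gX]] := @monomial_hom sigma' kappa'; first by move=> i /sP'[].
exists f, g; split=> //; split; apply: (hom_ext (g := id)) => //=.
- exact: (hom_comp fM gM).
- by rewrite f1.
- move=> i ri; have [rs ts ss ks] := sP i ri.
  rewrite fX // (homX gM) gX // ss -expgnA mulnC -[RHS]expg1; apply/eqP.
  by rewrite X_eq // ks.
- exact: (hom_comp gM fM).
- by rewrite g1.
- move=> i ri; have [rs ts ss ks] := sP' i ri.
  rewrite gX // (homX fM) fX // ss -expgnA mulnC -[RHS]expg1; apply/eqP.
  by rewrite X_eq // ks.
Qed.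

(** Decidability of [P] lets [xchoose] pick witnesses without a choice axiom; outside the range the
    value defaults to 0. *)
Lemma choose_nat (P : nat -> nat -> bool) :
  (forall i, rng i -> exists j, P i j) ->
  exists sigma : nat -> nat, forall i, rng i -> P i (sigma i).
Proof.
move=> H; exists (fun i => if @idP (rng i) is ReflectT ri then xchoose (H i ri) else 0%N).
by move=> i ri; case: {-}_ / idP => // ri'; apply: (xchooseP (H i ri')).
Qed.

(** * The groups [C] and [G] through the images of the [x_i] *)

Definition power_aut : autset W := fun f =>
  [/\ is_aut f, f w1 = w1 & forall i, rng i -> exists a, f (X i) = X i ^+ a].

Definition graph_aut : autset W := fun f =>
  [/\ is_aut f, f w1 = w1 & forall i, rng i -> exists2 j, rng j & f (X i) = X j].

Lemma power_aut_subgroup : aut_subgroup power_aut.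
Proof.
split.
- by move=> f [].
- move=> f g [fA f1 fX] fg; split; rewrite -?fg //; first exact: is_aut_ext fA fg.
  by move=> i /fX; rewrite fg.
- by split=> // [|i _]; [exact: is_aut_id | exists 1%N; rewrite expg1].
- move=> f g [fA f1 fX] [gA g1 gX]; split=> /=; first exact: is_aut_comp.
    by rewrite g1.
  move=> i ri; have [a ea] := fX i ri; have [b eb] := gX i ri.
  by exists (a * b)%N; rewrite eb (homX (proj1 fA)) ea expgnA.
move=> f g [[fM fB] f1 fX] fg; have gM := inv_of_hom fM fg; split.
- exact: is_aut_inv gM (inv_ofC fg).
- exact: inv_of_fix fg f1.
move=> i ri; have [a ea] := fX i ri.
by have [] := fix_w1_inv_X fM fg f1 ri ri ea.
Qed.

Lemma graph_aut_subgroup : aut_subgroup graph_aut.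
Proof.
split.
- by move=> f [].
- move=> f g [fA f1 fX] fg; split; rewrite -?fg //; first exact: is_aut_ext fA fg.
  by move=> i /fX; rewrite fg.
- by split=> // [|i ri]; [exact: is_aut_id | exists i].
- move=> f g [fA f1 fX] [gA g1 gX]; split=> /=; first exact: is_aut_comp.
    by rewrite g1.
  by move=> i /gX[j /fX[k rk ek] ->]; exists k.
move=> f g [[fM fB] f1 fX] fg; have gM := inv_of_hom fM fg; split.
- exact: is_aut_inv gM (inv_ofC fg).
- exact: inv_of_fix fg f1.
move=> i ri; have [fK gK] := fg.
have [j [a [rj _ gX]]] := fix_w1_X gM (can_inj gK) (inv_of_fix fg f1) ri.
have [k rk fXj] := fX j rj.
have e : X i ^+ 1 = X k ^+ a by rewrite -fXj -(homX fM) -gX gK.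
exists j => //; apply: (can_inj fK).
by rewrite gK fXj -(X_inj ri rk (X_neq1 ri) e).
Qed.

(* Membership in C only asks that each x_i goes to a power
   of itself, coprimality of the exponent being automatic for automorphisms. *)
Lemma power_aut_gen f : Cgrp n t w f <-> power_aut f.
Proof.
split.
  apply; first exact: power_aut_subgroup.
  move=> {}f [i [ri]]; apply; first exact: power_aut_subgroup.
  move=> {}f [k [_ _ fA fw fi]].
  have f1 : f w1 = w1 by apply: fw; lia.
  split=> // j rj; case: (eqVneq j i) => [->|ne].
    by exists k; rewrite (proj1 fA) f1 fi w1KA.
  by exists 1%N; rewrite (proj1 fA) f1 fw //; lia.
move=> fC P PS sP; have [_ Pext Pid Pcomp _] := PS.
(* Induction on a bound [m] for the indices that [f] moves; each step splits off a factor in one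
   [C_i]. *)
suff claim m : (forall i, rng i -> (m < i)%N -> f (X i) = X i) -> P f.
  by apply: (claim n) => i ri lt_n; lia.
elim: m f fC => [|m IH] f fC fX.
  have [[fM _] f1 _] := fC.
  by apply: Pext Pid _; apply: hom_ext => // i ri; rewrite fX //; lia.
have [rm|nrm] := boolP (rng m.+1); last first.
  apply: IH => // i ri lt_m; apply: fX => //.
  by case: (eqVneq i m.+1) => [ei|]; [rewrite -ei ri in nrm | lia].
have [fA f1 /(_ _ rm)[a fXm]] := fC.
have [fM _] := fA; have [f' ff'] := aut_inv fA.
have [_ co_a _] := fix_w1_inv_X fM ff' f1 rm rm fXm.
have tm := t_gt2 rm.
have a0 : (0 < a)%N.
  by case: a co_a {fXm} => //; rewrite /coprime gcd0n; lia.
pose b := (egcdn a (t m.+1)).1.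
have eb : b * a = 1 %[mod t m.+1].
  rewrite /b; case: egcdnP => //= km kn e _; rewrite e.
  by rewrite (eqP co_a) modnMDl.
pose one_at c := fun i : nat => if i == m.+1 then c else 1%N.
have [||g [g' [gM g1 gg' gX gX']]] := @monomial_aut id id (one_at a) (one_at b).
- by move=> i ri; split=> //; rewrite /one_at; case: eqP => // ->; rewrite mulnC.
- by move=> i ri; split=> //; rewrite /one_at; case: eqP => // ->.
have gA := is_aut_inv gM gg'; have g'M := inv_of_hom gM gg'.
have gw j : (1 <= j <= n)%N -> j != m.+1 -> g (w j) = w j.
  case/range_w=> [-> //|rj] ne; apply: (mulgI w1).
  by rewrite -{1}g1 -gM gX // /one_at (negbTE ne) expg1.
(* [f = (f g') g], where [g] raises only [x_(m+1)] to the power [a], so [f g'] fixes [x_(m+1)] as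
   well. *)
apply: (Pext ((f \o g') \o g)); last by move=> x /=; rewrite (proj1 gg').
apply: Pcomp.
  apply: IH => [|i ri lt_i /=].
    have [_ _ _ Ccomp Cinv] := power_aut_subgroup.
    apply: Ccomp => //; apply: Cinv gg'; split=> // i ri.
    by exists (one_at a i); rewrite gX.
  rewrite gX' // (homX fM) /one_at; case: eqP => [->|ne].
    by rewrite fXm -expgnA -[RHS]expg1; apply/eqP; rewrite X_eq // mulnC eb.
  by rewrite expg1 fX //; lia.
apply: sP; exists m.+1; split=> // Q QS; apply; exists (a %% t m.+1)%N; split=> //.
- rewrite ltn_mod lt0n; apply/andP; split; last lia.
  by apply: contraL co_a => /eqP a0'; rewrite -coprime_modl a0' /coprime gcd0n; lia.
- by rewrite coprime_modl.
rewrite expg_mod ?XT //; apply: (mulgI w1).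
by rewrite w1KA -{1}g1 -gM gX // /one_at eqxx.
Qed.

(** * Inner automorphisms and the decomposition of automorphisms *)

Lemma inner_aut (v : W) : is_aut (fun x => v^-1 * x * v).
Proof.
split; first by move=> x y; rewrite !mulgA mulgK.
by exists (fun x => v * x * v^-1) => x; rewrite !mulgA ?mulVg ?mulgV mul1g ?mulgK ?mulgVK.
Qed.

(** The image of [w_1] is an involution outside F, hence a conjugate of [w_1]; undoing this
    conjugation leaves an automorphism fixing [w_1]. *)
Lemma aut_decomp (k : W -> W) : is_aut k -> exists v k1,
  [/\ is_aut k1, k1 w1 = w1 & forall x, k x = v^-1 * k1 x * v].
Proof.
move=> kA; have [kM [k' kk' k'k]] := kA.
have [|s rs es] := @hom_w1_odd k kM; first by exists (k' w1).
have [|g eg] := involution_conj es rs; first by rewrite -kM w1K hom1.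
exists g^-1, (fun x => g^-1 * k x * g); split=> [||x].
- exact: is_aut_comp (inner_aut g) kA.
- by rewrite eg !mulgA mulVg mul1g mulgVK.
- by rewrite invgK !mulgA mulgV mul1g mulgK.
Qed.

(** The index maps [s] and [s'] of [f] and its inverse are mutually inverse and preserve [t]. So [s]
    defines a graph automorphism [g], and [f g^-1] sends each [x_i] to a power of itself. *)
Lemma fix_w1_decomp (f : W -> W) : is_aut f -> f w1 = w1 ->
  exists c g, [/\ power_aut c, graph_aut g & f =1 c \o g].
Proof.
move=> fA f1; have [fM _] := fA; have [f' ff'] := aut_inv fA.
have [fK f'K] := ff'; have f'M := inv_of_hom fM ff'.
have indexP (h : W -> W) : is_hom h -> injective h -> h w1 = w1 ->
    exists s : nat -> nat, forall i, rng i -> rng (s i) /\ exists a, h (X i) = X (s i) ^+ a.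
  move=> hM h_inj h1.
  (* Bounding the exponent by [t j] makes the relation decidable, as [choose_nat] requires. *)
  have [i ri|s sP] := @choose_nat
    (fun i j => rng j && has (fun a => h (X i) == X j ^+ a) (iota 0 (t j))).
    have [j [a [rj aj ->]]] := fix_w1_X hM h_inj h1 ri.
    exists j; rewrite rj; apply/hasP; exists a => //.
    by rewrite mem_iota; lia.
  by exists s => i /sP/andP[-> /hasP[a _ /eqP ->]]; split=> //; exists a.
have [s sP] := indexP f fM (can_inj fK) f1.
have [s' s'P] := indexP f' f'M (can_inj f'K) (inv_of_fix ff' f1).
have s'K i : rng i -> s' (s i) = i.
  move=> ri; have [rs [a ea]] := sP i ri; have [rs' [b eb]] := s'P _ rs.
  apply/esym/(@X_inj i _ 1 (b * a)) => //; first exact: X_neq1.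
  by rewrite expgnA -eb -(homX f'M) -ea fK.
have sK i : rng i -> s (s' i) = i.
  move=> ri; have [rs [a ea]] := s'P i ri; have [rs' [b eb]] := sP _ rs.
  apply/esym/(@X_inj i _ 1 (b * a)) => //; first exact: X_neq1.
  by rewrite expgnA -eb -(homX fM) -ea f'K.
have ts i : rng i -> t (s i) = t i.
  move=> ri; have [rs [a ea]] := sP i ri.
  by have [] := fix_w1_inv_X fM ff' f1 ri rs ea.
have ts' i : rng i -> t (s' i) = t i.
  by move=> ri; have [rs _] := s'P i ri; rewrite -(ts _ rs) sK.
have [||g [g' [gM g1 gg' gX g'X]]] := @monomial_aut s s' (fun=> 1%N) (fun=> 1%N).
- by move=> i ri; have [rs _] := sP i ri; rewrite ts ?s'K.
- by move=> i ri; have [rs _] := s'P i ri; rewrite ts' ?sK.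
have gA := is_aut_inv gM gg'; have g'M := inv_of_hom gM gg'.
have [gK g'K] := gg'.
exists (f \o g'), g; split; last by move=> x /=; rewrite gK.
  split; first exact: is_aut_comp fA (is_aut_inv g'M (inv_ofC gg')).
    by rewrite /= (inv_of_fix gg' g1).
  move=> i ri /=; have [rs' _] := s'P i ri.
  have [_ [a ea]] := sP _ rs'; exists a.
  by rewrite g'X // expg1 ea sK.
by split=> // i ri; have [rs _] := sP i ri; exists (s i); rewrite // gX // expg1.
Qed.

(** An automorphism permuting the [x_i] preserves their orders [t i], and equal orders mean the same
    block, so the blocks are preserved automatically. *)
Lemma graph_aut_Ggrp (l : nat) (k : nat -> nat) f :
  (forall j i, (1 <= j <= l)%N -> inA k j i -> rng i) ->
  (forall j i i', (1 <= j <= l)%N -> rng i' -> t i' = t i -> inA k j i -> inA k j i') ->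
  (forall i, rng i -> exists2 j, (1 <= j <= l)%N & inA k j i) ->
  Ggrp n l k w f <-> graph_aut f.
Proof.
move=> A_rng A_t A_cover; split.
  move=> [alpha [a_rng _ _ [fA f1] fw]]; split=> // i ri.
  by exists (alpha i); [exact: a_rng | rewrite (proj1 fA) f1 fw].
move=> [fA f1 fX]; have [fM _] := fA; have [f' ff'] := aut_inv fA.
have [i /fX[j rj ->]|alpha aP] := @choose_nat (fun i j => rng j && (f (X i) == X j)).
  by exists j; rewrite rj eqxx.
have aX i : rng i -> f (X i) = X (alpha i) by move=> /aP/andP[_ /eqP].
have a_rng i : rng i -> rng (alpha i) by move=> /aP/andP[].
exists alpha; split=> // [i i' ri ri' e|j i lj Aj|i ri].
- apply: (@X_inj i i' 1 1) => //; first exact: X_neq1.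
  by rewrite !expg1; apply: (can_inj (proj1 ff')); rewrite !aX ?e.
- have ri := A_rng _ _ lj Aj; apply: A_t Aj => //; first exact: a_rng.
  have [] := @fix_w1_inv_X f f' i (alpha i) 1 fM ff' f1 ri (a_rng _ ri) _ => //.
  exact: aX.
- by apply: (mulgI w1); rewrite -{1}f1 -fM aX.
Qed.

Lemma hat_power : power_aut (hat w1).
Proof.
split; [exact: hat_aut | exact: hat_w1 |] => i ri.
exists (t i - 1)%N; rewrite hat_X // XV ?expg1 //; have := t_gt2 ri; lia.
Qed.

Lemma cyc_hatP f : cyc (hat w1) f <-> f =1 id \/ f =1 hat w1.
Proof.
split; last first.
  move=> fE P [_ Pext Pid _ _] sP; case: fE => fE.
    by apply: Pext Pid _ => x; rewrite fE.
  by apply: sP.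
move/(_ (fun g => g =1 id \/ g =1 hat w1)); apply; last by move=> {}f fE; right.
split.
- by move=> {}f [] fE;
    [apply: is_aut_ext is_aut_id _ | apply: is_aut_ext hat_aut _] => x; rewrite fE.
- by move=> {}f g [] fE fg; [left | right] => x; rewrite -fg fE.
- by left.
- by move=> {}f g [] fE [] gE; [left|right|right|left] => x /=; rewrite fE gE // hatK.
- move=> {}f g [] fE [fK gK]; [left|right] => x; first by rewrite -[LHS]fE gK.
  by rewrite -{2}(gK x) fE hatK.
Qed.

Lemma Inn_subgroup : aut_subgroup (@Inn W).
Proof.
split.
- by move=> f [v fE]; apply: is_aut_ext (inner_aut v) _ => x; rewrite fE.
- by move=> f g [v fE] fg; exists v => x; rewrite -fg.
- by exists 1 => x; rewrite invg1 mul1g mulg1.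
- move=> f g [u fE] [v gE]; exists (v * u) => x /=.
  by rewrite fE gE invgM !mulgA.
- move=> f g [u fE] [fK gK]; exists u^-1 => x.
  apply: (can_inj fK); rewrite gK fE invgK.
  by rewrite !mulgA mulVg mul1g mulgVK.
Qed.

(** The conjugating element centralizes [w_1]. As [C] fixes [w_1], this bounds the intersection of
    [Inn] with [C]. *)
Lemma fix_w1_Inn f : Inn f -> f w1 = w1 -> cyc (hat w1) f.
Proof.
move=> [u fE] f1; apply/cyc_hatP.
have [|eu|eu] := @centralizer_w1 u.
- by rewrite -{1}f1 fE !mulgA mulgV mul1g.
- by left=> x; rewrite fE eu invg1 mul1g mulg1.
- by right=> x; rewrite fE eu w1V.
Qed.

Lemma Inn_normalized : normalized (@Inn W) (@Aut W).
Proof.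
move=> k k' f [kM _] [kK k'K] [u fE]; exists (k u) => x /=.
by rewrite fE !kM homV // k'K.
Qed.

Lemma aprod_Inn_subgroup (H : autset W) : aut_subgroup H ->
  aut_subgroup (aprod (@Inn W) H).
Proof.
move=> [HA Hext Hid Hcomp Hinv]; have [IA Iext Iid Icomp Iinv] := Inn_subgroup.
split.
- move=> f [i [h [Ii Hh fE]]]; apply: (is_aut_ext (f := i \o h)) => [|x]; last by rewrite fE.
  exact: is_aut_comp (IA _ Ii) (HA _ Hh).
- by move=> f g [i [h [Ii Hh fE]]] fg; exists i, h; split=> // x; rewrite -fg.
- by exists id, id.
- move=> f f2 [i [h [Ii Hh fE]]] [i2 [h2 [Ii2 Hh2 fE2]]].
  have [h' hh'] := aut_inv (HA _ Hh); have [hK h'K] := hh'.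
  (* [(i h)(i2 h2) = (i (h i2 h^-1)) (h h2)], and [h i2 h^-1] is inner. *)
  exists (i \o (h \o i2 \o h')), (h \o h2); split.
  + by apply: Icomp => //; apply: Inn_normalized hh' Ii2; apply: HA.
  + exact: Hcomp.
  + by move=> x; rewrite /= fE /= fE2 /= hK.
move=> f f' [i [h [Ii Hh fE]]] [fK f'K].
have [h' hh'] := aut_inv (HA _ Hh); have [hK h'K] := hh'.
have [i' ii'] := aut_inv (IA _ Ii); have [iK i'K] := ii'.
exists (h' \o i' \o h), h'; split.
- apply: (Inn_normalized (k := h')); last exact: Iinv ii'.
  + by apply/HA/Hinv/hh'.
  + exact: inv_ofC.
- exact: Hinv hh'.
- move=> x /=; rewrite h'K; apply: (can_inj fK); rewrite f'K fE /=.
  by rewrite h'K i'K.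
Qed.

(** Up to an inner factor, [k] is some [k1] fixing [w_1]. If [k1^-1] sends [x_j] to a power of
    [x_m], and [c] raises [x_m] to the power [a], then [k1 c k1^-1] raises [x_j] to the power
    [a]. *)
Lemma aprod_Inn_power_normalized : normalized (aprod (@Inn W) power_aut) (@Aut W).
Proof.
move=> k k' f kA [kK k'K] [i [c [[u iE] [cA c1 cX] fE]]].
have kM := proj1 kA; have [v [k1 [k1A k11 kE]]] := aut_decomp kA.
have [k1' kk1] := aut_inv k1A; have [k1K k1'K] := kk1.
have k1M := proj1 k1A; have k1'M := inv_of_hom k1M kk1.
have k1'1 := inv_of_fix kk1 k11; have cM := proj1 cA.
have k'E x : k' x = k1' (v * x * v^-1).
  by apply: (can_inj kK); rewrite k'K kE k1'K !mulgA mulVg mul1g mulgVK.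
pose c' := k1 \o c \o k1'.
have c'A : is_aut c'.
  exact: is_aut_comp (is_aut_comp k1A cA) (is_aut_inv k1'M (inv_ofC kk1)).
have c'C : power_aut c'.
  split=> // [|j rj]; first by rewrite /c' /= k1'1 c1.
  have [m [b [rm _ eb]]] := fix_w1_X k1'M (can_inj k1'K) k1'1 rj.
  have [a ea] := cX m rm; exists a.
  by rewrite /c' /= eb (homX cM) ea -expgnA mulnC expgnA -eb (homX k1M) k1'K.
(* The conjugator collects [k u] from [f], [v] from [k], and [c' v^-1] from [k'] after its passage
   through [c']. *)
exists (fun x => (c' v^-1 * v * k u)^-1 * x * (c' v^-1 * v * k u)), c'; split=> //.
  by exists (c' v^-1 * v * k u).
move=> x; rewrite /= fE /= iE !kM (homV kM) k'E (kE (c _)).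
have -> : k1 (c (k1' (v * x * v^-1))) = c' (v * x * v^-1) by [].
by rewrite !(proj1 c'A) !(homV (proj1 c'A)) !invgM invgK !mulgA.
Qed.

(** * The two semidirect products for a given complement *)

Section Complement.

Variable D : autset W.
Hypotheses (D_subgroup : aut_subgroup D) (DC : fsubset D (Cgrp n t w)).
Hypotheses (D_hat : trivInt D (cyc (hat w1))).
Hypothesis CD : fseteq (Cgrp n t w) (aprod D (cyc (hat w1))).

(** [hat w_1] is inner and commutes with every member of [D], which fixes [w_1]; so the cyclic
    factor of a member of [C] is absorbed into [Inn]. *)
Lemma aprod_Inn_complement f : aprod (@Inn W) D f <-> aprod (@Inn W) power_aut f.
Proof.
have [IA Iext Iid Icomp Iinv] := Inn_subgroup.
split=> -[i [c [Ii Cc fE]]].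
  by exists i, c; split=> //; exact: (power_aut_gen c).1 (DC Cc).
have /CD[d [e [Dd /cyc_hatP eE cE]]] := (power_aut_gen c).2 Cc.
case: eE => eE; first by exists i, d; split=> // x; rewrite fE /= cE /= eE.
have [dA d1 _] := (power_aut_gen d).1 (DC Dd).
exists (i \o hat w1), d; split=> //.
  by apply: Icomp => //; exists w1 => x; rewrite w1V.
by move=> x; rewrite fE /= cE /= eE /hat !(proj1 dA) d1.
Qed.

Lemma Inn_sdprod_complement : sdprod_int (@Inn W) D (aprod (@Inn W) (Cgrp n t w)).
Proof.
have [CA Cext Cid Ccomp Cinv] := power_aut_subgroup.
have [IA Iext Iid Icomp Iinv] := Inn_subgroup.
have C_subgroup : aut_subgroup (Cgrp n t w).
  split=> [f|f g|| f g|f g]; rewrite ?power_aut_gen //; eauto.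
have K_subgroup := aprod_Inn_subgroup C_subgroup.
split=> //.
- split; first by move=> f If; exists f, id; split=> //; apply/power_aut_gen.
  move=> k k' f Kk; apply: Inn_normalized.
  by case: K_subgroup => KA _ _ _ _; apply: KA.
- move=> f If Df; apply: D_hat => //; apply: fix_w1_Inn => //.
  by case: ((power_aut_gen f).1 (DC Df)).
move=> f; rewrite aprod_Inn_complement.
by split=> -[i [c [Ii Cc fE]]]; exists i, c; split=> //; apply/power_aut_gen.
Qed.

Lemma Aut_sdprod_graph (G : autset W) : (forall f, G f <-> graph_aut f) ->
  sdprod_int (aprod (@Inn W) D) G (@Aut W).
Proof.
move=> GE.
have [GA Gext Gid Gcomp Ginv] := graph_aut_subgroup.
have G_subgroup : aut_subgroup G.
  split=> [f|f g|| f g|f g]; rewrite ?GE //; eauto.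
have K_subgroup := aprod_Inn_subgroup D_subgroup.
have [KA _ _ _ _] := K_subgroup.
split=> //; first exact: is_aut_subgroup.
- split=> // k k' f kA kk' /aprod_Inn_complement Kf.
  by apply/aprod_Inn_complement/aprod_Inn_power_normalized.
- move=> f /aprod_Inn_complement[i [c [Ii Cc fE]]] /GE[[fM _] f1 fX].
  have [cA c1 cX] := Cc.
  (* Since [i] fixes [w_1], it is the identity or [hat w_1], so [i c] sends each [x_j] to a power of
     itself; this image is also some [x_m], hence [x_j]. *)
  have i1 : i w1 = w1 by rewrite -{1}c1 -[LHS]/((i \o c) w1) -fE.
  have [_ _ fP] : power_aut f.
    have [_ Cext _ Ccomp _] := power_aut_subgroup.
    apply: (Cext (i \o c)); last by move=> x; rewrite fE.
    apply: Ccomp => //; case/cyc_hatP: (fix_w1_Inn Ii i1) => iE.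
      by apply: (Cext id) => [|x]; [case: power_aut_subgroup | rewrite iE].
    by apply: Cext hat_power _ => x; rewrite iE.
  apply: hom_ext => // j rj; have [m rm em] := fX j rj; have [a ea] := fP j rj.
  rewrite em (X_inj rm rj (X_neq1 rm) (b := a)) // expg1.
  by rewrite -em.
move=> f; split=> [fA|[g [h [/KA gA /GE[hA _ _] fE]]]]; last first.
  by apply: (is_aut_ext (f := g \o h)) => [|x]; [exact: is_aut_comp | rewrite fE].
have [v [f1 [f1A f11 fE]]] := aut_decomp fA.
have [c [g [Cc Gg f1E]]] := fix_w1_decomp f1A f11.
exists ((fun x => v^-1 * x * v) \o c), g; split.
- by apply/aprod_Inn_complement; exists (fun x => v^-1 * x * v), c; split=> //; exists v.
- exact/GE.
- by move=> x; rewrite fE f1E.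
Qed.

End Complement.

(** * Existence of a complement by a quadratic character *)

Lemma complement_exists p i0 : prime p -> p %% 4 = 3 -> rng i0 -> p %| t i0 ->
  exists D : autset W, [/\ aut_subgroup D, fsubset D (Cgrp n t w),
    trivInt D (cyc (hat w1)) & fseteq (Cgrp n t w) (aprod D (cyc (hat w1)))].
Proof.
move=> p_pr p4 ri p_t; have p_gt1 := prime_gt1 p_pr.
(* [h = (p - 1) / 2] is odd because [p = 3] modulo 4. *)
pose h := p.-1./2.
have oh : odd h by rewrite /h; lia.
have hh : (h * 2)%N = p.-1 by rewrite /h; lia.
have X_modp a b : X i0 ^+ a = X i0 ^+ b -> a = b %[mod p].
  move/eqP; rewrite X_eq // => /eqP e.
  by rewrite -(modn_dvdm a p_t) e modn_dvdm.
have powE a b : X i0 ^+ a = X i0 ^+ b -> a ^ h = b ^ h %[mod p].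
  by move/X_modp => e; rewrite -modnXm e modnXm.
(* [a ^ h] mod p is the Legendre symbol of the exponent [a]. *)
pose D : autset W := fun f =>
  power_aut f /\ exists2 a, f (X i0) = X i0 ^+ a & a ^ h = 1 %[mod p].
have [CA Cext Cid Ccomp Cinv] := power_aut_subgroup.
have ti := t_gt2 ri.
(* [hat w_1] has exponent [t i0 - 1], which is [-1] modulo [p]; as [h] is odd, its symbol is
   [-1]. *)
have neg1 : p %| ((t i0 - 1) ^ h).+1.
  by apply: dvdn_odd_expS => //; rewrite subn1 prednK //; lia.
have hatX : hat w1 (X i0) = X i0 ^+ (t i0 - 1).
  by rewrite hat_X // XV ?expg1 //; lia.
exists D; split.
- split.
  + by move=> f [/CA].
  + by move=> f g [Cf [a fa a1]] fg; split; [apply: Cext fg | exists a; rewrite -?fg].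
  + by split=> //; exists 1%N; rewrite ?expg1 ?exp1n.
  + move=> f g [Cf [a fa a1]] [Cg [b gb b1]]; split; first exact: Ccomp.
    exists (a * b)%N; first by rewrite /= gb (homX (proj1 (CA _ Cf))) fa expgnA.
    by rewrite expnMn -modnMm a1 b1 modnMm.
  + move=> f g [Cf [a fa a1]] fg; have Cg := Cinv _ _ Cf fg; split=> //.
    have [_ _ /(_ _ ri)[b gb]] := Cg; exists b => //.
    have e : X i0 ^+ (a * b) = X i0 ^+ 1.
      by rewrite expgnA -fa -(homX (proj1 (CA _ Cf))) -gb (proj2 fg) expg1.
    by have := powE _ _ e; rewrite exp1n expnMn -modnMm a1 modnMm mul1n.
- by move=> f [Cf _]; apply/power_aut_gen.
- move=> f [_ [a fa a1]] /cyc_hatP[] // fE; exfalso.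
  (* If [hat w_1] were in [D], then [1 = -1] modulo [p], against [p > 2]. *)
  have := powE a (t i0 - 1)%N; rewrite -fa fE hatX => /(_ erefl).
  rewrite a1 => e; move: neg1; rewrite -addn1 /dvdn -modnDml -e modnDml addn1.
  by have p2 : p != 2 by [apply/eqP; lia]; rewrite modn_small //; lia.
move=> f; split; last first.
  move=> [d [e [[Cd _] /cyc_hatP eE fE]]]; apply/power_aut_gen.
  case: eE => eE; first by apply: Cext Cd _ => x; rewrite fE /= eE.
  by apply: Cext (Ccomp _ _ Cd hat_power) _ => x; rewrite fE /= eE.
move/power_aut_gen => Cf; have [fA f1 /(_ _ ri)[a fa]] := Cf.
have [f' ff'] := aut_inv fA.
have [_ co_a _] := fix_w1_inv_X (proj1 fA) ff' f1 ri ri fa.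
(* By Euler's theorem the symbol of [a] squares to 1 modulo the prime [p], so it is [1] or [-1]. *)
have a2 : (a ^ h) ^ 2 = 1 %[mod p].
  rewrite -expnM hh -totient_prime //; apply: Euler_exp_totient.
  exact: coprime_dvdr p_t co_a.
have [a1|a1] : a ^ h = 1 %[mod p] \/ p %| (a ^ h).+1.
  have a0 : (0 < a ^ h)%N.
    by rewrite expn_gt0; case: a co_a {fa a2} => //; rewrite /coprime gcd0n; lia.
  move/eqP: a2; rewrite eqn_mod_dvd; last by rewrite (expn_gt0 (a ^ h)) a0.
  rewrite -{2}(exp1n 2) subn_sqr Euclid_dvdM // addn1 -eqn_mod_dvd //.
  by case/orP => [/eqP|]; [left | right].
- exists f, id; split=> //; last by apply/cyc_hatP; left.
  by split=> //; exists a.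
(* When the symbol is [-1], composing with [hat w_1] makes it [1]. *)
exists (f \o hat w1), (hat w1); split=> //; last first.
- by move=> x; rewrite /= hatK.
- by apply/cyc_hatP; right.
split; first exact: Ccomp hat_power.
exists (a * (t i0 - 1))%N; first by rewrite /= hatX (homX (proj1 fA)) fa expgnA.
rewrite expnMn; have [x ex] := dvdnP a1; have [y ey] := dvdnP neg1.
(* This is [(x p - 1)(y p - 1) = 1] modulo [p], expanded without subtraction. *)
have : ((x + y) * p + (a ^ h * (t i0 - 1) ^ h) = x * p * y * p + 1)%N.
  by rewrite mulnDl -(mulnA (x * p)%N) -ex -ey mulSn mulnS; lia.
by move/(congr1 (modn^~ p)); rewrite !modnMDl.
Qed.

End NormalForms.

(** * Blocks and the final assembly *)

Lemma block_cover (k : nat -> nat) l i : (2 <= i < 2 + \sum_(1 <= r < l.+1) k r)%N ->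
  exists2 j, (1 <= j <= l)%N & inA k j i.
Proof.
elim: l => [|l IH]; first by rewrite big_geq //; lia.
move=> i_lt; case: (ltnP i (2 + \sum_(1 <= r < l.+1) k r)) => [lt_i|le_i].
  by have [|j lj Aj] := IH; [lia | exists j => //; lia].
by exists l.+1; rewrite ?/inA ?le_i //; lia.
Qed.

Lemma block_range (k : nat -> nat) l j i : (1 <= j <= l)%N -> inA k j i ->
  (2 <= i < 2 + \sum_(1 <= r < l.+1) k r)%N.
Proof.
move=> lj /andP[le_i lt_i].
rewrite (big_cat_nat (n := j.+1)) //=; lia.
Qed.

Theorem theorem4p4 (n l : nat) (m k t : nat -> nat) (W : groupType) (w : nat -> W) :
  (3 <= n)%N ->
  (forall j, (1 <= j <= l)%N -> odd (m j) /\ (3 <= m j)%N) ->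
  (forall j j', (1 <= j <= l)%N -> (1 <= j' <= l)%N -> m j = m j' -> j = j') ->
  (forall j, (1 <= j <= l)%N -> (1 <= k j)%N) ->
  (\sum_(1 <= j < l.+1) k j)%N = (n - 1)%N ->
  (forall j i, (1 <= j <= l)%N -> inA k j i -> t i = m j) ->
  presents n t w ->
  (exists p i, [/\ prime p, p %% 4 = 3, (1 <= i <= l)%N & p %| m i]) ->
  (exists D : autset W, [/\ aut_subgroup D, fsubset D (Cgrp n t w),
       trivInt D (cyc (hat (w 1%N))) & fseteq (Cgrp n t w) (aprod D (cyc (hat (w 1%N))))])
  /\
  (forall D : autset W, aut_subgroup D -> fsubset D (Cgrp n t w) ->
     trivInt D (cyc (hat (w 1%N))) -> fseteq (Cgrp n t w) (aprod D (cyc (hat (w 1%N)))) ->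
     sdprod_int (@Inn W) D (aprod (@Inn W) (Cgrp n t w)) /\
     sdprod_int (aprod (@Inn W) D) (Ggrp n l k w) (@Aut W)).
Proof.
move=> n3 m_odd m_inj k_gt0 sum_k tE presW [p [j0 [p_pr p4 lj0 p_m]]].
have n0 : (0 < n)%N by lia.
have sum_n : (2 + \sum_(1 <= r < l.+1) k r = n.+1)%N by rewrite sum_k; lia.
have A_rng j i : (1 <= j <= l)%N -> inA k j i -> (2 <= i <= n)%N.
  by move=> lj /(block_range lj); rewrite sum_n; lia.
have A_cover i : (2 <= i <= n)%N -> exists2 j, (1 <= j <= l)%N & inA k j i.
  by move=> ri; apply: block_cover; rewrite sum_n; lia.
have t_odd i : (2 <= i <= n)%N -> odd (t i).
  by case/A_cover=> j lj Aj; rewrite (tE j) //; case: (m_odd j lj).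
have t_gt2 i : (2 <= i <= n)%N -> (2 < t i)%N.
  by case/A_cover=> j lj Aj; rewrite (tE j) //; case: (m_odd j lj).
split.
  (* The first index of the nonempty block [A_j0]; there [t i0 = m j0] is divisible by [p]. *)
  pose i0 := (2 + \sum_(1 <= r < j0) k r)%N.
  have A0 : inA k j0 i0.
    rewrite /inA leqnn /= big_nat_recr /=; last by case/andP: lj0.
    by rewrite addnA -[X in (X < _)%N]addn0 ltn_add2l k_gt0.
  apply: (complement_exists n0 t_odd t_gt2 presW p_pr p4 (A_rng _ _ lj0 A0)).
  by rewrite (tE j0).
move=> D DS DC D_hat CD; split.
  exact: (Inn_sdprod_complement n0 t_odd t_gt2 presW DS DC D_hat CD).
apply: (Aut_sdprod_graph n0 t_odd t_gt2 presW DS DC CD) => f.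
apply: (graph_aut_Ggrp n0 t_odd t_gt2 presW _ A_rng _ A_cover).
(* Distinct blocks carry distinct [m j], so equal values of [t] put [i] and [i'] in one block. *)
move=> j i i' lj ri' et Aj; have [j' lj' Aj'] := A_cover i' ri'.
by rewrite (m_inj j j') // -(tE j i) // -et (tE j').
Qed.
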